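(* Let $D$ be a finite directed multigraph containing at least one directed triangle. Let $\nu_c(D)$ be the maximum size of a family of pairwise arc-disjoint directed triangles in $D$, and let $\tau_c(D)$ be the minimum size of a set $Y$ of arcs of $D$ such that $D-Y$ contains no directed triangle. Then $\tau_c(D) < 2\,\nu_c(D)$.
   Context: A directed multigraph is an orientation of a multigraph: it has a finite vertex set and a finite collection of arcs, each arc having a tail and a head that are distinct vertices (no loops). Several parallel arcs from $u$ to $v$ in the same direction are permitted and are regarded as distinct arcs; arcs in both directions $u \to v$ and $v \to u$ between the same two vertices (digons) are also permitted. A directed triangle in $D$ is a directed cycle of length three, i.e. three arcs $u \to v$, $v \to w$, $w \to u$ of $D$ with $u, v, w$ three distinct vertices. Triangles using different parallel arcs are different triangles. Two directed triangles are arc-disjoint if they have no arc in common (using different parallel arcs between the same two vertices does not count as sharing an arc). For a set $Y$ of arcs, $D - Y$ is the directed multigraph obtained from $D$ by deleting the arcs in $Y$; the size of $Y$ counts parallel arcs individually. *)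

(* Defs.v *)
From mathcomp Require Import all_boot.

Set Implicit Arguments.
Unset Strict Implicit.
Unset Printing Implicit Defensive.

(* Arcs form a type of their own, so parallel arcs and digons are allowed. *)
Record dimultigraph := DiMultigraph {
  dvertex : finType;
  darc : finType;
  dtail : darc -> dvertex;
  dhead : darc -> dvertex;
  loopless : forall a : darc, dtail a != dhead a
}.

(* A directed triangle is represented by its set of arcs, which determines it;
   triangles using different parallel arcs are thus different. *)
Definition is_triangle (D : dimultigraph) (T : {set darc D}) : bool :=
  [exists a : darc D, exists b : darc D, exists c : darc D,
    [&& T == [set a; b; c],
        dhead a == dtail b, dhead b == dtail c, dhead c == dtail a &
        uniq [:: dtail a; dtail b; dtail c]]].

Definition has_triangle (D : dimultigraph) : bool :=
  [exists T : {set darc D}, is_triangle T].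

Definition del_arcs (D : dimultigraph) (Y : {set darc D}) : dimultigraph :=
  @DiMultigraph (dvertex D) {a : darc D | a \notin Y}
    (fun a => dtail (val a)) (fun a => dhead (val a))
    (fun a => loopless (val a)).

(* Triangles are nonempty sets of arcs, so counting a family as a set of
   triangles loses nothing: arc-disjoint triangles are distinct. *)
Definition triangle_packing (D : dimultigraph) (F : {set {set darc D}}) : bool :=
  [forall T in F, is_triangle T] && trivIset F.

Definition nu_c (D : dimultigraph) : nat :=
  \max_(F : {set {set darc D}} | triangle_packing F) #|F|.

Definition triangle_transversal (D : dimultigraph) (Y : {set darc D}) : bool :=
  ~~ has_triangle (del_arcs Y).

(* [arg min] is a genuine minimizer only if its default value satisfies the
   constraint. *)
Lemma triangle_transversalT (D : dimultigraph) :
  triangle_transversal [set: darc D].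
Proof.
apply/existsP=> -[T /existsP[a _]].
by have := valP a; rewrite inE.
Qed.

Definition tau_c (D : dimultigraph) : nat :=
  #|[arg min_(Y < [set: darc D] | triangle_transversal Y) #|Y| ]|.

(* Main.v *)
Require Import Defs.
From mathcomp Require Import all_boot zify.

(** Fix a vertex v of a triangle. The triangles through v are the paths of
    length three from v back to v, so Menger's theorem (menger_through_cut)
    gives an arc-disjoint family T of them and a set S of arcs meeting all of
    them with |S| = |T| = k. Let M consist of the k arcs of T not incident with
    v, and let R be the union of S and M. A triangle that shares an arc with T
    either passes through v, and is met by S, or avoids v, and then the shared
    arc lies in M. Hence the triangles that avoid R are arc-disjoint from T, and
    if there are any, then induction on the number of arcs, applied to the
    complement of R, gives the bound: R has at most 2k arcs and T has k
    triangles.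

    Suppose now that R meets all triangles. The theorem holds unless every
    transversal has at least 2k arcs; then R is a minimum transversal with
    exactly 2k arcs and S is disjoint from M, so that all arcs which S shares
    with T are incident with v. In this case T is not a maximum packing
    (larger_packing): k + 1 arc-disjoint triangles exist, which is more than
    half of |R|. Pick an arc s of S in a triangle of T. By minimality of R some
    triangle P meets R exactly in s. Then P passes through v, and only its two
    arcs at v can be shared with T, so P meets at most two triangles of T. Call
    U the set of these, and N the set of their arcs in M. Put the arcs of N
    back, that is, delete only R minus N: the remaining triangles cannot be
    covered by fewer than |U| arcs. As |U| is 1 or 2, the strict bound given by
    induction turns this into a packing F of |U| of them. The triangles of F
    avoid v and meet T only in N. The only arc of P they could contain is its
    arc p opposite v. But each of them contains an arc of N, since R meets it; p
    is not in R, hence different from that arc, and has the same tail or the same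
    head, because P shares an arc at v with each triangle of U (off_shared). No
    triangle contains two different arcs with the same tail or the same head.
    Replacing U by F and P in T therefore gains one triangle. *)

Set Implicit Arguments.
Unset Strict Implicit.
Unset Printing Implicit Defensive.

(** * Finite sets and disjoint families *)

Section DisjointFamilies.
Variable T : finType.
Implicit Types (A B : {set T}) (F : {set {set T}}).

Lemma card_cover_setI A F :
  trivIset F -> #|cover F :&: A| = \sum_(B in F) #|B :&: A|.
Proof.
move=> tI; rewrite -sum1_card.
rewrite (eq_bigl (fun x => (x \in cover F) && (x \in A))); last first.
  by move=> x; rewrite inE.
rewrite big_trivIset_cond //; apply: eq_bigr => B _.
by rewrite -sum1_card; apply: eq_bigl => x; rewrite inE.
Qed.

Lemma leq_cardD_setUI A1 A2 B1 B2 :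
    A1 :|: A2 \subset B1 :|: B2 -> A1 :&: A2 \subset B1 :&: B2 ->
  #|A1| + #|A2| <= #|B1| + #|B2|.
Proof.
by move=> sU sI; rewrite -[leqLHS]cardsUI -[leqRHS]cardsUI leq_add // subset_leq_card.
Qed.

End DisjointFamilies.

(** * Triangles in a set of arcs *)

Section Triangles.
Variable D : dimultigraph.
Implicit Types (E S Y t g : {set darc D}) (F : {set {set darc D}}).
Implicit Types (a b : darc D) (v : dvertex D) (X Z : {set dvertex D}).

Definition triangles E := [set t | is_triangle t & t \subset E].

Definition packing E F := (F \subset triangles E) && trivIset F.

Definition covers F Y := [forall t in F, ~~ [disjoint t & Y]].

Definition off v := [set a | (dtail a != v) && (dhead a != v)].

Definition through v := [set t | is_triangle t & [exists a in t, a \notin off v]].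

Lemma coversP F Y : reflect {in F, forall t, ~~ [disjoint t & Y]} (covers F Y).
Proof. exact: forall_inP. Qed.

(** The three tails are distinct as soon as the arcs are consecutive, since
    there are no loops. *)
Lemma triangleP t :
  reflect (exists a b c, [/\ t = [set a; b; c], dhead a = dtail b,
             dhead b = dtail c & dhead c = dtail a])
    (is_triangle t).
Proof.
apply: (iffP existsP) => [[a /existsP[b /existsP[c]]]|[a [b [c]]]].
  by case/and5P=> /eqP-> /eqP ab /eqP bc /eqP ca _; exists a, b, c.
case=> -> ab bc ca; exists a; apply/existsP; exists b; apply/existsP; exists c.
move: (loopless a) (loopless b) (loopless c); rewrite ab bc ca => ta tb tc.
by rewrite !eqxx /= !inE negb_or ta tb (eq_sym (dtail a)) tc.
Qed.

(** Listing the arcs of a triangle from v onwards exhibits it as a path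
    of length three from v to v. *)
Lemma throughP v t :
  reflect (exists o m i, [/\ t = [set o; m; i], dtail o = v,
             dhead o = dtail m, dhead m = dtail i & dhead i = v])
    (t \in through v).
Proof.
have rot (a b c : darc D) : [set a; b; c] = [set b; c; a].
  by rewrite -setUA setUC.
rewrite inE; apply: (iffP andP) => [[/triangleP[a [b [c [-> ab bc ca]]]]]|].
  case/exists_inP=> x; rewrite !inE negb_and !negbK.
  case/orP=> [/orP[]|] /eqP-> /orP[] /eqP xv.
  - by exists a, b, c; split=> //; rewrite ca.
  - by exists b, c, a; split=> //; rewrite ?rot // -ab.
  - by exists b, c, a; split=> //; rewrite ?rot // ab.
  - by exists c, a, b; split=> //; rewrite ?rot // -bc.
  - by exists c, a, b; split=> //; rewrite ?rot // bc.
  - by exists a, b, c; split=> //; rewrite -ca.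
case=> o [m [i [-> ov om mi iv]]]; split.
  by apply/triangleP; exists o, m, i; split; rewrite ?iv.
by apply/exists_inP; exists o; rewrite !inE ?ov eqxx.
Qed.

Lemma through_triangle v t : t \in through v -> is_triangle t.
Proof. by rewrite inE => /andP[]. Qed.

Lemma inner_ends v o m i :
    dtail o = v -> dhead o = dtail m -> dhead m = dtail i -> dhead i = v ->
  [/\ (dtail m == v) = false, (dhead m == v) = false & (dtail i == v) = false].
Proof.
move=> ov om mi iv; rewrite -mi -om -{1}ov eq_sym (negPf (loopless o)).
by rewrite mi -iv (negPf (loopless i)).
Qed.

Lemma triangle_neq0 t : is_triangle t -> t != set0.
Proof.
case/triangleP=> a [b [c [-> _ _ _]]]; apply/set0Pn; exists a.
by rewrite !inE eqxx.
Qed.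

Lemma triangle_inj g a b :
    is_triangle g -> a \in g -> b \in g ->
    dtail a = dtail b \/ dhead a = dhead b ->
  a = b.
Proof.
case/triangleP=> x [y [z [-> xy yz zx]]].
move: (loopless x) (loopless y) (loopless z).
rewrite xy yz zx => /eqP nx /eqP ny /eqP nz.
by rewrite !inE => /orP[/orP[]|] /eqP-> /orP[/orP[]|] /eqP-> [] //;
  rewrite ?xy ?yz ?zx => e; first [by case: nx | by case: ny | by case: nz].
Qed.

Lemma trianglesS E1 E2 : E1 \subset E2 -> triangles E1 \subset triangles E2.
Proof.
move=> sE; apply/subsetP=> t; rewrite !inE => /andP[-> sub_t] /=.
exact: subset_trans sub_t sE.
Qed.

Lemma coversU E S Y :
  covers (triangles (E :\: S)) Y -> covers (triangles E) (S :|: Y).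
Proof.
move=> /coversP covY; apply/coversP=> t; rewrite !inE => /andP[tri_t sub_t].
apply/negP; rewrite disjoints_subset setCU subsetI -!disjoints_subset.
case/andP=> tS; apply/negP/covY.
by rewrite !inE tri_t subsetD sub_t.
Qed.

Lemma covers_residual E S : triangles (E :\: S) = set0 -> covers (triangles E) S.
Proof.
move=> tri0; rewrite -[S]setU0; apply: coversU; apply/coversP=> t.
by rewrite tri0 inE.
Qed.

(** Triangles are nonempty, so two families without common arcs are disjoint
    as families and their sizes add up. *)
Lemma packingU E F1 F2 :
    packing E F1 -> packing E F2 ->
    (forall t g, t \in F1 -> g \in F2 -> [disjoint t & g]) ->
  packing E (F1 :|: F2) /\ #|F1 :|: F2| = #|F1| + #|F2|.
Proof.
case/andP=> s1 tI1 /andP[s2 tI2] dis; split.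
  rewrite /packing subUset s1 s2 trivIsetU //; apply/pred0P=> a /=.
  apply/negP=> /andP[/bigcupP[t tF1 at_] /bigcupP[g gF2 ag]].
  by have /pred0P/(_ a) := dis t g tF1 gF2; rewrite /= at_ ag.
have F12_0 : F1 :&: F2 = set0.
  apply/setP=> t; rewrite !inE; apply/negP=> /andP[t1 t2].
  have := subsetP s1 t t1; rewrite inE => /andP[/triangle_neq0].
  by have := dis t t t1 t2; rewrite -setI_eq0 setIid => /eqP->; rewrite eqxx.
by rewrite cardsU F12_0 cards0 subn0.
Qed.

Lemma packing1 E t : t \in triangles E -> packing E [set t].
Proof. by move=> tE; rewrite /packing sub1set tE trivIset1. Qed.

Lemma packingS E1 E2 F : E1 \subset E2 -> packing E1 F -> packing E2 F.
Proof.
move=> sE /andP[sF tF]; rewrite /packing tF andbT.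
exact: subset_trans sF (trianglesS sE).
Qed.

Lemma card_off v t : t \in through v -> #|t :&: off v| = 1.
Proof.
case/throughP=> o [m [i [-> ov om mi iv]]].
have [mv mv' _] := inner_ends ov om mi iv.
apply/eqP/cards1P; exists m; apply/setP=> a; rewrite !inE.
have [->|_] := eqVneq a m; first by rewrite orbT mv mv'.
rewrite orbF; apply/negP=> /andP[/orP[] /eqP-> ].
  by rewrite ov eqxx.
by rewrite iv eqxx andbF.
Qed.

(** The shared arc z leads from v to the common tail of p and m, or from their
    common head to v. *)
Lemma off_shared v t u p m z :
    t \in through v -> u \in through v -> z \in t -> z \in u -> z \notin off v ->
    p \in t :&: off v -> m \in u :&: off v ->
  dtail p = dtail m \/ dhead p = dhead m.
Proof.
have spoke w q : w \in through v -> z \in w -> z \notin off v -> q \in w :&: off v ->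
    dtail z = v /\ dhead z = dtail q \/ dhead z = v /\ dtail z = dhead q.
  case/throughP=> o [n [i [-> ov on ni iv]]].
  rewrite !inE => /orP[/orP[]|] /eqP-> Hz /andP[/orP[/orP[]|] /eqP->];
    rewrite ?ov ?iv ?eqxx ?andbF //; try by move/negP: Hz.
  - by left.
  - by right; split.
move=> tv uv zt zu nz pt mu.
have := loopless z; have := spoke t p tv zt nz pt; have := spoke u m uv zu nz mu.
case=> [] [zv zm] [] [zv' zp]; first by left; rewrite -zm.
- by rewrite zv zv' eqxx.
- by rewrite zv zv' eqxx.
- by right; rewrite -zm.
Qed.

(** * Menger's theorem for the triangles through a vertex *)

(** Split each vertex other than v into a left copy, entered from v, and a right
    copy, from which arcs lead back to v; the other arcs go from left to right.
    This is the cut of that network whose source side consists of v, the left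
    copies of X and the right copies of Z. *)
Definition cut v X Z :=
  [set a | if dtail a == v then dhead a \notin X
           else if dhead a == v then dtail a \in Z
           else (dtail a \in X) && (dhead a \notin Z)].

Lemma covers_cut v X Z : covers (through v) (cut v X Z).
Proof.
apply/coversP=> t /throughP[o [m [i [-> ov om mi iv]]]].
have [mv mv' iv'] := inner_ends ov om mi iv.
apply/negP=> /pred0P dis.
have := dis o; have := dis m; have := dis i.
rewrite /= !inE !eqxx ?orbT /= ov iv mv mv' iv' eqxx mi om.
by move=> ->; rewrite andbT => ->.
Qed.

(** Submodularity of cuts holds arc by arc. *)
Lemma leq_card_cut v E X1 X2 Z1 Z2 :
  #|E :&: cut v (X1 :&: X2) (Z1 :&: Z2)| + #|E :&: cut v (X1 :|: X2) (Z1 :|: Z2)|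
    <= #|E :&: cut v X1 Z1| + #|E :&: cut v X2 Z2|.
Proof.
apply: leq_cardD_setUI; apply/subsetP=> a; rewrite !inE;
  case: (a \in E) => //=; case: (dtail a == v).
- by case: (dhead a \in X1); case: (dhead a \in X2).
- case: (dhead a == v); first by case: (dtail a \in Z1); case: (dtail a \in Z2).
  by case: (dtail a \in X1); case: (dtail a \in X2);
    case: (dhead a \in Z1); case: (dhead a \in Z2).
- by case: (dhead a \in X1); case: (dhead a \in X2).
- case: (dhead a == v); first by case: (dtail a \in Z1); case: (dtail a \in Z2).
  by case: (dtail a \in X1); case: (dtail a \in X2);
    case: (dhead a \in Z1); case: (dhead a \in Z2).
Qed.

(** When no triangle passes through v, v cannot reach itself, and the source
    side can be taken to consist of the vertices reachable from v. *)
Lemma cut_eq0 v E : triangles E :&: through v = set0 ->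
  exists X Z, E :&: cut v X Z = set0.
Proof.
move=> no_tri; pose X := [set dhead a | a in E & dtail a == v].
pose Z := [set dhead a | a in E & [&& dtail a != v, dhead a != v & dtail a \in X]].
exists X, Z; apply/setP=> a; rewrite !inE; apply/negP=> /andP[aE].
case: ifP => [av|av].
  by case/negP; apply/imsetP; exists a; rewrite ?inE ?aE.
case: ifP => [av' |av'].
  case/imsetP=> m; rewrite inE => /and4P[mE mv mv'].
  case/imsetP=> o; rewrite inE => /andP[oE ov] mo am.
  suff: [set o; m; a] \in triangles E :&: through v by rewrite no_tri inE.
  have tv : [set o; m; a] \in through v.
    by apply/throughP; exists o, m, a; split=> //; apply/eqP.
  rewrite inE tv inE (through_triangle tv) !andbT.
  by apply/subsetP=> x; rewrite !inE => /orP[/orP[]|] /eqP->.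
case/andP=> aX /negP[]; apply/imsetP; exists a => //.
by rewrite inE aE av av' aX.
Qed.

(** Induction on E, for a triangle t through v with inner arc m. Either deleting
    m keeps all cuts of size at least k, or deleting t keeps them of size at
    least k - 1, and t can be added to the family for E :\: t. Otherwise there are
    two small cuts; by submodularity, their intersection and union would
    together have fewer than 2k arcs of E. *)
Lemma menger_through v k E :
    (forall X Z, k <= #|E :&: cut v X Z|) ->
  exists F, [/\ packing E F, F \subset through v & #|F| = k].
Proof.
have [n] := ubnP #|E|; elim: n => // n IHn in k E *; rewrite ltnS => leEn.
case: k => [|k] lek.
  exists set0; rewrite /packing !sub0set cards0; split=> //=.
  by apply/trivIsetP=> A B; rewrite inE.
have [/cut_eq0[X [Z E0]]|[t]] := set_0Vmem (triangles E :&: through v).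
  by have := lek X Z; rewrite E0 cards0.
rewrite in_setI => /andP[tE /[dup] tv /throughP[o [m [i [def_t ov om mi iv]]]]].
have sub_t : t \subset E by move: tE; rewrite inE => /andP[].
have mE : m \in E by apply: (subsetP sub_t); rewrite def_t !inE eqxx orbT.
have [mv mv' iv'] := inner_ends ov om mi iv.
have ltE1 : #|E :\ m| < n by rewrite (leq_trans _ leEn) // [leqRHS](cardsD1 m) mE.
have [/forallP le1|/forallPn[X1 /forallPn[Z1]]] :=
  boolP [forall X, [forall Z, k < #|(E :\ m) :&: cut v X Z|]].
  have [X Z|F [pF Fv cF]] := IHn k.+1 _ ltE1; first by have /forallP := le1 X; apply.
  by exists F; rewrite (packingS (subD1set E m)).
rewrite -leqNgt => le1.
have ltE2 : #|E :\: t| < n.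
  apply: leq_ltn_trans ltE1; apply/subset_leq_card/setDS.
  by rewrite sub1set def_t !inE eqxx orbT.
have [/forallP le2|/forallPn[X2 /forallPn[Z2]]] :=
  boolP [forall X, [forall Z, k <= #|(E :\: t) :&: cut v X Z|]].
  have [X Z|F [pF Fv cF]] := IHn k _ ltE2; first by have /forallP := le2 X; apply.
  have [A B /set1P-> BF|pack cFU] := packingU (packing1 tE) (packingS (subsetDl E t) pF).
    have /andP[sF _] := pF; have := subsetP sF B BF; rewrite inE subsetD disjoint_sym.
    by case/and3P.
  exists ([set t] :|: F); rewrite pack cFU cards1 cF subUset sub1set tv /=.
  by split.
rewrite -ltnNge => lt2.
have neq_om : o != m by apply: contraFneq mv => <-; rewrite ov.
have neq_oi : o != i by apply: contraFneq iv' => <-; rewrite ov.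
have neq_mi : m != i by apply: contraFneq mv' => ->; rewrite iv.
have splitE S : #|E :&: S| = (o \in S) + (m \in S) + (i \in S) + #|(E :\: t) :&: S|.
  rewrite -(cardsID t) setIAC (setIidPr sub_t) setIDAC; congr (_ + _).
  rewrite -sum1_card (eq_bigl (fun a => (a \in t) && (a \in S))); last first.
    by move=> a; rewrite inE.
  rewrite big_mkcondr def_t -setUA big_setU1 ?inE ?negb_or ?neq_om //=.
  rewrite big_setU1 ?inE //= big_set1 addnA.
  by case: (o \in S); case: (m \in S); case: (i \in S).
have cutE X Z : ((o \in cut v X Z) = (dtail m \notin X))
    * ((m \in cut v X Z) = (dtail m \in X) && (dtail i \notin Z))
    * ((i \in cut v X Z) = (dtail i \in Z)).
  by rewrite !inE ov iv mv mv' iv' !eqxx om mi.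
have := cardsD1 m (E :&: cut v X1 Z1); rewrite -setIDAC in_setI mE /=.
(* submodularity is used on E :\: t because t may meet the second cut in two
   arcs; it meets the first cut, the intersection and the union in one each *)
have := leq_card_cut v (E :\: t) X1 X2 Z1 Z2.
have := lek X1 Z1; have := lek (X1 :&: X2) (Z1 :&: Z2).
have := lek (X1 :|: X2) (Z1 :|: Z2).
rewrite !splitE !cutE !in_setI !in_setU; move: le1 lt2.
move: #|(E :\ m) :&: _| #|(E :\: t) :&: cut v X1 Z1| #|(E :\: t) :&: cut v X2 Z2|.
move: #|_ :&: cut v (X1 :&: X2) _| #|_ :&: cut v (X1 :|: X2) _|.
move: (dtail m \in X1) (dtail m \in X2) (dtail i \in Z1) (dtail i \in Z2).
clear=> x1 x2 z1 z2 cI cU c0 c1 c2 le0 le2 leU leI le1 leIU eq1; exfalso.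
by case: x1 x2 z1 z2 le0 le2 leU leI le1 leIU eq1 => [] [] [] [] /=; lia.
Qed.

Lemma menger_through_cut v E :
  exists T S, [/\ packing E T, T \subset through v, S \subset E,
                  covers (triangles E :&: through v) S & #|S| = #|T|].
Proof.
case: (arg_minnP (fun p : {set dvertex D} * {set dvertex D} => #|E :&: cut v p.1 p.2|)
         (erefl true : predT (set0, set0))) => -[X0 Z0] _ /= min0.
have [X Z|T [pT Tv cT]] := @menger_through v #|E :&: cut v X0 Z0| E.
  exact: (min0 (X, Z) isT).
exists T, (E :&: cut v X0 Z0); split=> //; first exact: subsetIl.
apply/coversP=> t; rewrite 2!inE => /andP[/andP[_ sub_t] tv].
have := coversP _ _ (covers_cut v X0 Z0) t tv.
by rewrite -!setI_eq0 setIA (setIidPl sub_t).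
Qed.

(** * Improving the packing at a vertex *)

(** The strict inequality, with a packing and a transversal as witnesses in place
    of the two optima, and for all sets of arcs of the same multigraph, so that
    deleting arcs in the induction does not change the type of triangles. *)
Definition bounded_cover E :=
  exists F Y, [/\ packing E F, covers (triangles E) Y & #|Y| < 2 * #|F|].

Section AtVertex.
Variables (v : dvertex D) (E S : {set darc D}) (T : {set {set darc D}}).
Hypotheses (pT : packing E T) (Tv : T \subset through v).
Hypothesis covS : covers (triangles E :&: through v) S.
Hypothesis cST : #|S| = #|T|.

Let M := cover T :&: off v.
Let R := S :|: M.

Let sTE : T \subset triangles E. Proof. by case/andP: pT. Qed.
Let tT : trivIset T. Proof. by case/andP: pT. Qed.

Lemma card_off_cover (U : {set {set darc D}}) :
  U \subset T -> #|cover U :&: off v| = #|U|.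
Proof.
move=> sU; rewrite card_cover_setI ?(trivIsetS sU) // -sum1_card.
by apply: eq_bigr => u /(subsetP sU)/(subsetP Tv)/card_off.
Qed.

Lemma leq_card_transversal : #|R| <= 2 * #|T|.
Proof. by rewrite mul2n -addnn -{1}cST -(card_off_cover (subxx T)) leq_card_setU. Qed.

Lemma avoid_subset_off g :
  g \in triangles E -> [disjoint g & S] -> g \subset off v.
Proof.
move=> gE gS; apply/subsetP=> a ag; apply/negPn/negP=> av.
have := coversP _ _ covS g; rewrite in_setI gE gS /= => avoid.
suff /avoid : g \in through v by [].
by move: gE; rewrite !inE => /andP[-> _]; apply/exists_inP; exists a.
Qed.

(** This is why deleting R protects the packing T: what survives cannot share
    arcs with it. *)
Lemma avoid_setI_cover g u :
    g \in triangles E -> [disjoint g & S] -> u \in T -> g :&: u \subset M.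
Proof.
move=> gE gS uT; apply/subsetP=> a /setIP[ag au].
rewrite in_setI (subsetP (avoid_subset_off gE gS)) // andbT.
by apply/bigcupP; exists u.
Qed.

Lemma bounded_cover_step : bounded_cover (E :\: R) -> bounded_cover E.
Proof.
case=> F [Y [pF covY ltY]].
have [t g tF gF|pTF cTF] := packingU pT (packingS (subsetDl E R) pF).
  have /andP[sF _] := pF; have := subsetP sF g gF.
  rewrite inE subsetD => /and3P[tri_g sgE gR].
  have gE : g \in triangles E by rewrite inE tri_g.
  have gS : [disjoint g & S] := disjointWr (subsetUl S M) gR.
  have gM : g :&: M = set0 by apply/disjoint_setI0/(disjointWr (subsetUr S M) gR).
  rewrite disjoint_sym -setI_eq0 -subset0 -gM subsetI subsetIl.
  exact: avoid_setI_cover.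
exists (T :|: F), (R :|: Y); split=> //; first exact: coversU.
apply: leq_ltn_trans (leq_card_setU R Y) _.
by rewrite cTF mulnDr -addnS leq_add // leq_card_transversal.
Qed.

(** The only obstacle to the induction: R meets all triangles and no transversal
    is smaller than twice the packing. *)
Section Tight.
Hypothesis sSE : S \subset E.
Hypothesis T_neq0 : T != set0.
Hypothesis covR : covers (triangles E) R.
Hypothesis min_cover : forall Y, covers (triangles E) Y -> 2 * #|T| <= #|Y|.
Hypothesis IH :
  forall E', #|E'| < #|E| -> triangles E' != set0 -> bounded_cover E'.

Lemma card_transversal : #|R| = 2 * #|T|.
Proof. by apply/eqP; rewrite eqn_leq leq_card_transversal min_cover. Qed.

Lemma disjoint_cut_off : S :&: M = set0.
Proof.
apply/eqP; rewrite -cards_eq0 -leqn0 -(leq_add2l #|R|) cardsUI cST.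
by rewrite (card_off_cover (subxx T)) addnn -mul2n addn0 min_cover.
Qed.

Lemma restored_triangle (A : {set darc D}) :
  A \subset R -> A != set0 -> triangles (E :\: (R :\: A)) != set0.
Proof.
move=> sA; apply: contraNneq => /covers_residual/min_cover; rewrite -cards_eq0 -leqn0.
by rewrite -card_transversal -(cardsID A R) (setIidPr sA) -[leqRHS]add0n leq_add2r.
Qed.

Lemma private_triangle s :
  s \in R -> exists2 P, P \in triangles E & P :&: R = [set s].
Proof.
rewrite -sub1set => sR.
have s0 : [set s] != set0 by apply/set0Pn; exists s; rewrite set11.
have /set0Pn[P] := restored_triangle sR s0.
rewrite inE subsetD => /and3P[triP sPE disP].
have PE : P \in triangles E by rewrite inE triP.
have PRs : P :&: R \subset [set s] by move: disP; rewrite -setI_eq0 setIDA setD_eq0.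
exists P => //; apply/eqP; rewrite eqEsubset PRs sub1set.
have /pred0Pn[r /= rPR] := coversP _ _ covR P PE.
have rPR' : r \in P :&: R by rewrite inE.
by have /set1P<- := subsetP PRs r rPR'.
Qed.

(** The strict inequality at smaller sets of arcs is what produces |U| triangles:
    to cover the restored triangles takes |U| arcs, and a packing with
    |U| < 2|F| has |F| >= |U| as long as |U| <= 2. *)
Lemma restored_packing (U : {set {set darc D}}) (N := cover U :&: off v) :
    U \subset T -> U != set0 -> #|U| <= 2 ->
  exists2 F, packing (E :\: (R :\: N)) F & #|U| <= #|F|.
Proof.
move=> sUT U0 leU2; have cN : #|N| = #|U| by apply: card_off_cover.
have NM : N \subset M.
  by apply: setSI; apply/bigcupsP=> u uU; apply: bigcup_sup (subsetP sUT u uU).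
have NR : N \subset R := subset_trans NM (subsetUr S M).
have SRN : S \subset R :\: N.
  by rewrite subsetD subsetUl -setI_eq0 -subset0 -disjoint_cut_off setIS.
have ltEN : #|E :\: (R :\: N)| < #|E|.
  rewrite -[ltnRHS](cardsID S E) (setIidPr sSE) cST -[ltnLHS]add0n -addSn.
  by rewrite leq_add ?card_gt0 // subset_leq_card // setDS.
have N0 : N != set0 by rewrite -card_gt0 cN card_gt0.
have [F [Y [pF covY ltY]]] := IH ltEN (restored_triangle NR N0).
exists F => //; have leUY : #|U| <= #|Y|.
  have cRN : #|R :\: N| + #|U| = 2 * #|T|.
    by rewrite -cN -card_transversal -(cardsID N R) (setIidPr NR) addnC.
  rewrite -(leq_add2l #|R :\: N|) cRN.
  by apply: leq_trans (leq_card_setU _ _); apply: min_cover; apply: coversU.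
by clear -leU2 leUY ltY; lia.
Qed.

(** A triangle P whose only arc in R is an arc of S meets at most two triangles of T;
    exchanging these for as many restored triangles makes room for P. *)
Lemma larger_packing : exists2 F, packing E F & #|T| < #|F|.
Proof.
have /set0Pn[t tT0] := T_neq0.
have /pred0Pn[s /= /andP[st sS]] : ~~ [disjoint t & S].
  by apply: (coversP _ _ covS); rewrite in_setI (subsetP sTE) ?(subsetP Tv).
have sv : s \notin off v.
  apply/negP=> sv; have : s \in S :&: M.
    by rewrite inE sS inE sv andbT; apply/bigcupP; exists t.
  by rewrite disjoint_cut_off inE.
have sR : s \in R by rewrite inE sS.
have [P PE PR] := private_triangle sR.
have /setIP[sP _] : s \in P :&: R by rewrite PR set11.
have Pv : P \in through v.
  by move: PE; rewrite !inE => /andP[-> _]; apply/exists_inP; exists s.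
pose U := [set u in T | ~~ [disjoint u & P]].
have sUT : U \subset T by apply/subsetP=> u; rewrite inE => /andP[].
have U0 : U != set0.
  apply/set0Pn; exists t; rewrite inE tT0.
  by apply/pred0Pn; exists s; rewrite /= st.
have meetP u : u \in U -> exists2 z, z \in u :&: P & z \notin off v.
  rewrite inE => /andP[uT /pred0Pn[z /= /andP[zu zP]]].
  exists z; first by rewrite inE zu.
  apply/negP=> zv; have zM : z \in M by rewrite inE zv andbT; apply/bigcupP; exists u.
  have : z \in P :&: R by rewrite inE zP inE zM orbT.
  by rewrite PR => /set1P zs; rewrite zs (negPf sv) in zv.
(* each triangle of U takes at least one of the two arcs of P at v *)
have leU2 : #|U| <= 2.
  have leP : #|P :\: off v| <= 2.
    rewrite -(leq_add2l 1) -{1}(card_off Pv) cardsID.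
    case/throughP: Pv => o [m [i [-> _ _ _ _]]].
    by rewrite (leq_trans (leq_card_setU _ _)) // cards1 addnC leq_add2l cards2 ltnS leq_b1.
  apply: leq_trans leP; apply: leq_trans (subset_leq_card (subsetIr (cover U) _)).
  rewrite card_cover_setI ?(trivIsetS sUT) // -sum1_card; apply: leq_sum => u uU.
  have [z /setIP[zu zP] zv] := meetP u uU.
  by apply/card_gt0P; exists z; rewrite in_setI zu in_setD zv.
have [F pF leUF] := restored_packing sUT U0 leU2; pose N := cover U :&: off v.
have FE g : g \in F -> [/\ is_triangle g, g \in triangles E, [disjoint g & S]
    & g :&: R \subset N].
  have /andP[sF _] := pF; move/(subsetP sF).
  rewrite inE subsetD => /and3P[tri_g sgE gRN].
  have gE : g \in triangles E by rewrite inE tri_g.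
  have sgN : g :&: R \subset N by move: gRN; rewrite -setI_eq0 setIDA setD_eq0.
  split=> //; rewrite -setI_eq0 -subset0 -disjoint_cut_off setIC subsetI subsetIl /=.
  rewrite setIC; apply: subset_trans (setIS g (subsetUl S M)) _.
  apply: subset_trans sgN _; apply: setSI; apply/bigcupsP=> u uU.
  exact: bigcup_sup (subsetP sUT u uU).
have [g _ gF /set1P->|pFP cFP] :=
    packingU (packingS (subsetDl _ _) pF) (packing1 PE).
  have [tri_g gE gS gRN] := FE g gF.
  apply/pred0P=> a /=; apply/negP=> /andP[ag aP].
  have /pred0Pn[r /= /andP[rg rR]] := coversP _ _ covR g gE.
  have /setIP[/bigcupP[u uU ru] rv] : r \in N by rewrite (subsetP gRN) // inE rg.
  have [z /setIP[zu zP] zv] := meetP u uU.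
  have aPv : a \in P :&: off v by rewrite inE aP (subsetP (avoid_subset_off gE gS)).
  have ruv : r \in u :&: off v by rewrite inE ru.
  have uv := subsetP Tv u (subsetP sUT u uU).
  (* a and r have the same tail or the same head, so they are the same arc; but
     s is the only arc of P in R *)
  have ar := triangle_inj tri_g ag rg (off_shared Pv uv zP zu zv aPv ruv).
  have : a \in P :&: R by rewrite inE aP ar.
  by rewrite PR => /set1P a_s; rewrite -a_s ar rv in sv.
have pTU : packing E (T :\: U).
  by rewrite /packing (subset_trans (subsetDl T U)) ?trivIsetD.
have [u g|pTUF cTUF] := packingU pTU pFP.
  case/setDP=> uT uU /setUP[gF|/set1P->]; last first.
    by move: uU; rewrite inE uT negbK.
  have [_ gE gS gRN] := FE g gF.
  rewrite disjoint_sym; apply/pred0P=> a /=; apply/negP=> /andP[ag au].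
  have aM : a \in M by apply: (subsetP (avoid_setI_cover gE gS uT)); rewrite inE ag.
  have : a \in g :&: R by rewrite inE ag inE aM orbT.
  move/(subsetP gRN)=> /setIP[/bigcupP[u' u'U au'] _].
  have neq_u : u != u' by apply: contraNneq uU => ->.
  have /pred0P/(_ a) := trivIsetP tT u u' uT (subsetP sUT u' u'U) neq_u.
  by rewrite /= au au'.
exists ((T :\: U) :|: (F :|: [set P])) => //.
rewrite cTUF cFP cards1 addn1 addnS ltnS -(cardsID U T) (setIidPr sUT) addnC.
by rewrite leq_add2l.
Qed.

End Tight.
End AtVertex.

Lemma triangles_bounded_cover E : triangles E != set0 -> bounded_cover E.
Proof.
have [n] := ubnP #|E|; elim: n => // n IHn in E *; rewrite ltnS => leEn.
have IH E' : #|E'| < #|E| -> triangles E' != set0 -> bounded_cover E'.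
  by move=> ltE'; apply: IHn; apply: leq_trans ltE' leEn.
case/set0Pn=> t tE; have [v tv] : exists v, t \in through v.
  move: tE; rewrite inE => /andP[tri_t _].
  have /set0Pn[a at_] := triangle_neq0 tri_t; exists (dtail a).
  by rewrite inE tri_t; apply/exists_inP; exists a; rewrite // !inE eqxx.
have [T [S [pT Tv sSE covS cST]]] := menger_through_cut v E.
have /pred0Pn[s /= /andP[_ sS]] : ~~ [disjoint t & S].
  by apply: (coversP _ _ covS); rewrite in_setI tE.
have T0 : T != set0 by rewrite -card_gt0 -cST; apply/card_gt0P; exists s.
pose R := S :|: cover T :&: off v.
have [triR0|triR] := eqVneq (triangles (E :\: R)) set0; last first.
  apply: (bounded_cover_step pT Tv covS cST); apply: IH => //.
  apply: proper_card; rewrite properE subsetDl; apply/subsetPn.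
  by exists s; rewrite ?(subsetP sSE) // !inE sS.
have covR : covers (triangles E) R := covers_residual triR0.
have [/existsP[Y /andP[covY ltY]]|/existsPn min_cover] :=
    boolP [exists Y, covers (triangles E) Y && (#|Y| < 2 * #|T|)].
  by exists T, Y.
have [Y covY|F pF ltTF] := larger_packing pT Tv covS cST sSE T0 covR _ IH.
  by have := min_cover Y; rewrite covY /= -leqNgt.
exists F, R; split=> //; apply: leq_ltn_trans (leq_card_transversal pT Tv cST) _.
by rewrite ltn_pmul2l.
Qed.

End Triangles.

Theorem theorem1p1 (D : dimultigraph) (hD : has_triangle D) :
  tau_c D < 2 * nu_c D.
Proof.
have [|F [Y [pF covY ltY]]] := @triangles_bounded_cover D setT.
  by have /existsP[t tri_t] := hD; apply/set0Pn; exists t; rewrite inE tri_t subsetT.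
have packF : triangle_packing F.
  have /andP[sF tF] := pF; rewrite /triangle_packing tF andbT.
  by apply/forall_inP=> t /(subsetP sF); rewrite inE => /andP[].
have transY : triangle_transversal Y.
  apply/negP=> /existsP[t /triangleP[a [b [c [_ ab bc ca]]]]].
  have tri : is_triangle [set val a; val b; val c].
    by apply/triangleP; exists (val a), (val b), (val c).
  have := coversP _ _ covY [set val a; val b; val c]; rewrite inE tri subsetT.
  move/(_ isT)/negP; apply; apply/pred0P=> x /=; apply/negP=> /andP[].
  rewrite !inE => /orP[/orP[]|] /eqP-> xY.
  - by have := valP a; rewrite xY.
  - by have := valP b; rewrite xY.
  - by have := valP c; rewrite xY.
have le_tau : tau_c D <= #|Y|.
  rewrite /tau_c; case: arg_minnP => [|Y0 _]; first exact: triangle_transversalT.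
  exact.
have le_nu : #|F| <= nu_c D by apply: leq_bigmax_cond.
by apply: leq_ltn_trans le_tau (leq_trans ltY _); rewrite leq_mul2l.
Qed.
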